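(* Let $X_1,\dots,X_n$ be random variables such that $X_i\trianglelefteq_{\eta_i}0$ for some $\eta_1,\dots,\eta_n>0$, and let $S_n=\sum_{i=1}^nX_i$. Then: 1. Under no additional assumptions, $S_n\trianglelefteq_\eta0$ with $\eta=\left(\sum_{i=1}^n\frac1{\eta_i}\right)^{-1}$. 2. If $X_1,\dots,X_n$ are negatively associated (in particular, if they are independent), then $S_n\trianglelefteq_\eta0$ with $\eta=\min_i\eta_i$.
   Context: For $\eta>0$, $X\trianglelefteq_\eta Y$ means $\mathbf E[e^{\eta(X-Y)}]\le1$. Random variables $X_1,\dots,X_n$ are negatively associated if for any two disjoint index sets $I,J\subset\{1,\dots,n\}$, $\mathbf E[f(X_i,i\in I)\,g(X_j,j\in J)]\le\mathbf E[f(X_i,i\in I)]\,\mathbf E[g(X_j,j\in J)]$ for any choice of functions $f,g$ that are monotone increasing (increasing in each argument when the others are held fixed), whenever these expectations are well defined. *)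

(* Defs.v *)
From mathcomp Require Import all_boot all_order all_algebra.
From mathcomp Require Import all_classical all_reals all_analysis.
Set Implicit Arguments.
Unset Strict Implicit.
Unset Printing Implicit Defensive.
Import Order.TTheory GRing.Theory Num.Theory.
Import numFieldNormedType.Exports.

Local Open Scope classical_set_scope.
Local Open Scope ring_scope.

Section Definitions.
Context (R : realType) (d : measure_display) (T : measurableType d).
Context (P : probability T R).

(* The expectation is an extended real: [exp_le eta X Y] makes the exponential
   moment finite. It is meant for [0 < eta]. *)
Definition exp_le (eta : R) (X Y : T -> R) : Prop :=
  ('E_P[fun w => expR (eta * (X w - Y w))] <= 1)%E.

Definition coord_nondecreasing (k : nat) (f : k.-tuple R -> R) : Prop :=
  forall (i : 'I_k) (x y : k.-tuple R),
    (forall j, j != i -> tnth x j = tnth y j) ->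
    tnth x i <= tnth y i -> f x <= f y.

Context (n : nat).
Implicit Type X : 'I_n -> {RV P >-> R}.

Definition subvector X (I : {set 'I_n}) (w : T) : #|I|.-tuple R :=
  [tuple X (enum_val k) w | k < #|I|].

(* "Well defined" is read as: the test functions are Borel and the three
   expectations are those of integrable random variables. *)
Definition negatively_associated X : Prop :=
  forall (I J : {set 'I_n}) (f : #|I|.-tuple R -> R) (g : #|J|.-tuple R -> R),
    I :&: J = finset.set0 ->
    measurable_fun setT f -> measurable_fun setT g ->
    coord_nondecreasing f -> coord_nondecreasing g ->
    let fX := fun w => f (subvector X I w) in
    let gX := fun w => g (subvector X J w) in
    P.-integrable setT (EFin \o fX) ->
    P.-integrable setT (EFin \o gX) ->
    P.-integrable setT (EFin \o (fX \* gX)) ->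
    ('E_P[fX \* gX] <= 'E_P[fX] * 'E_P[gX])%E.

(* Taking some [A i] to be [setT] gives the product rule for subfamilies. *)
Definition mutually_independent X : Prop :=
  forall A : 'I_n -> set R, (forall i, measurable (A i)) ->
    P (\bigcap_i (X i @^-1` A i)) = (\prod_i P (X i @^-1` A i))%E.

End Definitions.

Notation "X '⊴_[' P , eta ] Y" := (exp_le P eta X Y)
  (at level 70, P at level 200, eta at level 200, Y at next level,
   format "X  '⊴_[' P ,  eta ]  Y") : ring_scope.

(* Main.v *)
(* Part 1 is Jensen's inequality for expR, with weights eta / eta_i which sum to
   1; the same inequality, with a single weight m / eta_i <= 1, shows that the
   hypotheses survive when every eta_i is lowered to the minimum m. Under negative
   association the expectation of a product of bounded nondecreasing
   nonnegative functions of the coordinates is at most the product of the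
   expectations; this is applied to the truncations min (expR (m x)) M, and M
   goes to infinity by monotone convergence. Under independence, the pi-lambda
   theorem applied to boxes makes f(X_I) and g(X_J) independent, and Fubini's
   theorem turns the inequality of negative association into an equality. *)
Require Import Defs.
From mathcomp Require Import all_boot all_order all_algebra.
From mathcomp Require Import all_classical all_reals all_analysis.
From mathcomp Require Import measurable_realfun ring.
Import Order.TTheory GRing.Theory Num.Theory.
Import numFieldNormedType.Exports.
Local Open Scope classical_set_scope.
Local Open Scope ring_scope.

(** * Convexity of the exponential and its integrated form *)

(** This is Jensen's inequality with the missing mass [1 - \sum_i a i] placed at the point 0, where
    [expR] equals 1. *)
Lemma expR_sum_convex (R : realType) (I : finType) (a x : I -> R) :
  (forall i, 0 <= a i) -> \sum_i a i <= 1 ->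
  expR (\sum_i a i * x i) <= \sum_i a i * expR (x i) + (1 - \sum_i a i).
Proof.
move=> a0 a1; set m := \sum_i a i * x i; set s := \sum_i a i.
(* sum the tangent-line bounds of expR at m *)
have tangent i : expR m * (1 + (x i - m)) <= expR (x i).
  rewrite -{2}(subrK m (x i)) [_ - m + m]addrC expRD ler_pM2l ?expR_gt0//.
  exact: expR_ge1Dx.
have lower : expR m * (s + m - s * m) <= \sum_i a i * expR (x i).
  suff -> : expR m * (s + m - s * m) =
            \sum_i a i * (expR m * (1 + (x i - m))).
    by apply: ler_sum => i _; rewrite ler_wpM2l.
  rewrite /s {2}/m mulr_suml -big_split/= -sumrB mulr_sumr.
  by apply: eq_bigr => i _; ring.
(* The tangent line at [m], evaluated at the extra point 0. *)
have m1 : expR m * (1 - m) <= 1.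
  by rewrite -[leRHS](expRxMexpNx_1 m) ler_pM2l ?expR_gt0 ?expR_ge1Dx.
apply: le_trans (lerD lower (lexx _)); rewrite -subr_ge0.
(* This product is exactly the gap left between [expR m] and the lower bound. *)
have : 0 <= (1 - s) * (1 - expR m * (1 - m)) by rewrite mulr_ge0 ?subr_ge0.
by congr (0 <= _); ring.
Qed.

(** The pointwise convexity bound is integrated; all integrands are nonnegative, so no integrability
    has to be checked. Total weight below 1 is allowed so that one weight can also shrink a single
    exponent. *)
Lemma expectation_expR_sum_le1 (R : realType) (d : measure_display)
    (T : measurableType d) (P : probability T R) (I : finType)
    (a : I -> R) (Y : I -> T -> R) :
  (forall i, measurable_fun setT (Y i)) ->
  (forall i, 0 <= a i) -> \sum_i a i <= 1 ->
  (forall i, 'E_P[fun w => expR (Y i w)] <= 1)%E ->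
  ('E_P[fun w => expR (\sum_i a i * Y i w)] <= 1)%E.
Proof.
move=> mY a0 a1 Y1; rewrite unlock.
have mexpY i : measurable_fun setT (EFin \o (fun w => expR (Y i w))).
  by apply/measurable_EFinP; exact: measurableT_comp.
have maY i : measurable_fun setT
    ((fun w => (a i)%:E * (expR (Y i w))%:E)%E : T -> \bar R).
  by apply: measurable_funeM; exact: mexpY.
have aY0 i w : (0 <= (a i)%:E * (expR (Y i w))%:E)%E.
  by rewrite -EFinM lee_fin mulr_ge0 ?expR_ge0.
apply: (@le_trans _ _ (\int[P]_w (\sum_i (a i)%:E * (expR (Y i w))%:E +
    (1 - \sum_i a i)%:E))%E).
  apply: ge0_le_integral => //.
  - apply/measurable_EFinP; apply: measurableT_comp => //.
    by apply: measurable_sum => i; exact: measurable_funM.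
  - by apply: emeasurable_funD => //; exact: emeasurable_sum.
  - move=> w _; rewrite (eq_bigr (fun i => (a i * expR (Y i w))%:E))//.
    by rewrite sumEFin -EFinD lee_fin expR_sum_convex.
rewrite ge0_integralD//; last 3 first.
- by move=> w _; exact: sume_ge0.
- exact: emeasurable_sum.
- by move=> w _; rewrite lee_fin subr_ge0.
rewrite ge0_integral_sum// integral_cst//= probability_setT mule1.
apply: (@le_trans _ _ (\sum_i (a i)%:E + (1 - \sum_i a i)%:E)%E); last first.
  by rewrite sumEFin -EFinD addrC subrK.
apply: leeD2r; apply: lee_sum => i _.
rewrite ge0_integralZl ?lee_fin//; last exact: mexpY.
rewrite -[leRHS]mule1 lee_wpmul2l ?lee_fin//.
by have := Y1 i; rewrite unlock.
Qed.

(** * Products of bounded monotone functions under negative association *)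

Section negative_association.
Context (R : realType) (d : measure_display) (T : measurableType d).
Context (P : probability T R) (n : nat) (X : 'I_n -> {RV P >-> R}).
Context (h : 'I_n -> R -> R) (M : R).
Hypotheses (h_nd : forall i, {homo h i : x y / x <= y}).
Hypotheses (h_ge0 : forall i x, 0 <= h i x) (h_leM : forall i x, h i x <= M).

Let prodh (A : {set 'I_n}) (t : #|A|.-tuple R) : R :=
  \prod_(k < #|A|) h (enum_val k) (tnth t k).

Let prodhE A w : prodh A (subvector X A w) = \prod_(i in A) h i (X i w).
Proof.
by rewrite big_enum_val; apply: eq_bigr => k _; rewrite tnth_mktuple.
Qed.

Let measurable_h i : measurable_fun setT (h i).
Proof. exact: nondecreasing_measurable. Qed.

Let measurable_prodh A : measurable_fun setT (prodh A).
Proof.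
apply: measurable_prod => k _.
by apply: measurableT_comp => //; exact: measurable_tnth.
Qed.

Let coord_nondecreasing_prodh A : coord_nondecreasing (prodh A).
Proof.
move=> i x y xy xyi; apply: ler_prod => k _; rewrite h_ge0/= h_nd//.
by have [->//|/xy ->] := eqVneq k i.
Qed.

Let integrable_prod (A : {set 'I_n}) :
  P.-integrable setT (EFin \o (fun w => \prod_(i in A) h i (X i w))).
Proof.
apply: measurable_bounded_integrable => //.
- by rewrite /= probability_setT ltry.
- under eq_fun do rewrite big_enum_val/=.
  by apply: measurable_prod => k _; exact: measurableT_comp.
- exists (\prod_(i in A) M); split; first exact: num_real.
  move=> x Mx w _; apply: le_trans (ltW Mx).
  by rewrite ger0_norm ?prodr_ge0// ler_prod// => i _; rewrite h_ge0 h_leM.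
Qed.

(** Indices are split off one at a time: negative association is applied to [[set a]] and [A :\ a].
    The product over [A :\ a] is an admissible test function because its factors are nonnegative and
    nondecreasing; boundedness gives integrability. *)
Lemma negatively_associated_prod (A : {set 'I_n}) :
  negatively_associated X ->
  ('E_P[fun w => (\prod_(i in A) h i (X i w))%R] <=
   \prod_(i in A) 'E_P[fun w => h i (X i w)])%E.
Proof.
move=> NA; have [k] := ubnP #|A|; elim: k A => // k IH A.
have [->|/finset.set0Pn[a aA]] := eqVneq A finset.set0.
  move=> _; rewrite big_set0.
  rewrite (_ : (fun _ => _) = cst 1) ?expectation_cst//.
  by apply/funext => w; rewrite big_set0.
rewrite (cardsD1 a) aA add1n ltnS => /IH{}IH.
have split w : \prod_(i in A) h i (X i w) =
    h a (X a w) * \prod_(i in A :\ a) h i (X i w) by rewrite (big_setD1 a).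
have one w : prodh [set a]%SET (subvector X [set a]%SET w) = h a (X a w).
  by rewrite prodhE big_set1.
rewrite (big_setD1 a)//=.
have E0 : (0 <= 'E_P[fun w => h a (X a w)])%E by exact: expectation_ge0.
apply: le_trans (lee_wpmul2l E0 IH).
have dis : ([set a] :&: (A :\ a) = finset.set0)%SET.
  by apply/finset.setP => i; rewrite !inE; case: eqVneq.
have := NA _ _ _ _ dis (measurable_prodh _) (measurable_prodh _)
  (@coord_nondecreasing_prodh _) (@coord_nondecreasing_prodh _).
rewrite /= (funext one) (funext (prodhE (A :\ a)%SET)).
rewrite (_ : _ \* _ = fun w => \prod_(i in A) h i (X i w)); last first.
  by apply/funext => w /=; rewrite split.
apply.
- have := integrable_prod [set a]%SET.
  by under eq_fun do rewrite big_set1.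
- exact: integrable_prod.
- exact: integrable_prod.
Qed.

End negative_association.

(** * From independence of coordinates to factorized expectations *)

Section independence.
Context (R : realType) (d : measure_display) (T : measurableType d).
Context (P : probability T R).

(** For fixed [V], both sides are finite measures in [A]: the law of [Y] under [P] restricted to
    [V], and the law of [Y] scaled by [P V]. Agreement on a generating pi-system forces equality. *)
Lemma pi_system_independent d' (T' : measurableType d') (G : set (set T'))
    (Y : {RV P >-> T'}) (V : set T) :
  measurable = <<s G >> -> setI_closed G -> G setT -> measurable V ->
  (forall A, G A -> P (Y @^-1` A `&` V) = P (Y @^-1` A) * P V)%E ->
  forall A, measurable A -> P (Y @^-1` A `&` V) = (P (Y @^-1` A) * P V)%E.
Proof.
move=> mG GI GT mV GV A mA.
have PV0 : 0 <= fine (P V) by rewrite fine_ge0.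
pose m1 : {measure set T' -> \bar R} := pushforward (mrestr P mV) Y.
pose m2 : {measure set T' -> \bar R} := mscale (NngNum PV0) (distribution P Y).
have m2E B : m2 B = (P (Y @^-1` B) * P V)%E.
  by rewrite /m2/= /mscale/= fineK ?fin_num_measure// muleC.
rewrite -m2E.
(* Since [G] contains [setT], the constant sequence [setT] serves as the exhausting cover of finite
   mass. *)
apply: (@measure_unique _ _ _ G (fun=> setT) mG GI _ _
  (m1 (measurable_funPT Y)) m2) => //.
- by rewrite bigcup_const//; exists 0%N.
- by move=> B GB; rewrite m2E -GV.
- by move=> _; rewrite /m1/= /pushforward/= /mrestr preimage_setT setTI
    -ge0_fin_numE ?fin_num_measure.
Qed.

Definition tuple_box {k} (A : 'I_k -> set R) : set (k.-tuple R) :=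
  [set t | forall i, A i (tnth t i)].

Definition tuple_boxes k : set (set (k.-tuple R)) :=
  [set tuple_box A | A in [set A : 'I_k -> set R | forall i, measurable (A i)]].

Lemma setI_closed_tuple_boxes k : setI_closed (@tuple_boxes k).
Proof.
move=> _ _ [A mA <-] [B mB <-]; exists (fun i => A i `&` B i).
  by move=> i; exact: measurableI.
by apply/seteqP; split => [t AB|t [At Bt] i];
  [split => i; have [] := AB i|split].
Qed.

Lemma tuple_boxes_setT k : @tuple_boxes k setT.
Proof. by exists (fun=> setT) => //; apply/seteqP; split. Qed.

(** The sigma-algebra on tuples is generated by coordinate preimages, which are boxes with one
    nontrivial side; conversely a box is a finite intersection of such preimages. *)
Lemma measurable_tuple_boxes k :
  @measurable _ (k.-tuple R) = <<s @tuple_boxes k >>.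
Proof.
apply/seteqP; split.
- apply: smallest_sub; first exact: smallest_sigma_algebra.
  move=> C; rewrite -bigcup_seq/= => -[i _] [A mA <-].
  apply: sub_sigma_algebra; exists (fun j => if j == i then A else setT).
    by move=> j; case: ifP.
  rewrite setTI; apply/seteqP; split => t /=.
    by move=> /(_ i); rewrite eqxx.
  by move=> Ati j; case: eqP => // ->.
- apply: smallest_sub; first exact: sigma_algebra_measurable.
  move=> _ [A mA <-].
  rewrite (_ : tuple_box A = \bigcap_i ((@tnth k R)^~ i @^-1` A i)).
    apply: fin_bigcap_measurable => // i _; rewrite -[X in measurable X]setTI.
    exact: measurable_tnth.
  by apply/seteqP; split => [t At i _|t At i]; [exact: At|exact: At].
Qed.

Lemma expectationM_independent (U V : {RV P >-> R}) :
  (forall A B, measurable A -> measurable B ->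
    P (U @^-1` A `&` V @^-1` B) = P (U @^-1` A) * P (V @^-1` B))%E ->
  P.-integrable setT (EFin \o U) -> P.-integrable setT (EFin \o V) ->
  P.-integrable setT (EFin \o (U \* V)) ->
  ('E_P[U \* V] = 'E_P[U] * 'E_P[V])%E.
Proof.
move=> indep iU iV iUV.
have mUV : measurable_fun setT (fun w => (U w, V w)) by exact: measurable_fun_pair.
pose UV : {RV P >-> (R * R)%type} := mfun_Sub (mem_set mUV).
pose mu := distribution P U; pose nu := distribution P V.
(* Independence says that the joint law and the product of the marginals agree on rectangles, hence
   everywhere. *)
have lawE A : measurable A -> (mu \x nu)%E A = distribution P UV A.
  apply: product_measure_unique => B C mB mC.
  by rewrite -indep.
have mprod : measurable_fun setT (fun z : R * R => (z.1 * z.2)%:E).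
  by apply/measurable_EFinP; exact: measurable_funM.
have lawint (f : R * R -> \bar R) :
    (\int[mu \x nu]_z f z = \int[distribution P UV]_z f z)%E.
  by apply: eq_measure_integral => A mA _; exact: lawE.
have iprod : (mu \x nu)%E.-integrable setT (fun z : R * R => (z.1 * z.2)%:E).
  apply/integrableP; split => //; rewrite lawint ge0_integral_distribution//.
  - by have /integrableP[] := iUV.
  - exact: measurableT_comp.
rewrite unlock; transitivity (\int[mu \x nu]_z (z.1 * z.2)%:E)%E.
  by rewrite lawint integral_distribution.
rewrite -integral12_prod_meas1//.
have EV : (\int[nu]_y y%:E = \int[P]_w (V w)%:E)%E.
  by rewrite integral_distribution//; exact/measurable_EFinP.
have iVnu : nu.-integrable setT (fun y => y%:E).
  apply: integrable_pushforward => //; exact/measurable_EFinP.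
transitivity (\int[mu]_x (x%:E * \int[P]_w (V w)%:E))%E.
  apply: eq_integral => x _; rewrite /fubini_F/= -EV -integralZl//.
have /fineK <- : (\int[P]_w (V w)%:E)%E \is a fin_num.
  exact: integrable_fin_num.
rewrite integralZr//; last first.
  apply: integrable_pushforward => //; exact/measurable_EFinP.
by rewrite integral_distribution//; exact/measurable_EFinP.
Qed.

End independence.
Arguments tuple_box {R k} A.

Lemma mutually_independent_negatively_associated (R : realType)
    (d : measure_display) (T : measurableType d) (P : probability T R)
    (n : nat) (X : 'I_n -> {RV P >-> R}) :
  mutually_independent X -> negatively_associated X.
Proof.
move=> indep K L f g KL mf mg _ _ fX gX ifX igX ifgX.
have msub (D : {set 'I_n}) : measurable_fun setT (subvector X D).
  apply/measurable_fun_tnthP => k.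
  by rewrite (_ : _ \o _ = X (enum_val k))//; apply/funext => w /=;
    rewrite tnth_mktuple.
pose Y (D : {set 'I_n}) : {RV P >-> #|D|.-tuple R} := mfun_Sub (mem_set (msub D)).
(* the constraint that a box in the coordinates [D] puts on the [i]-th one:
   it is [setT] for [i] outside [D] *)
pose ext (D : {set 'I_n}) (A : 'I_#|D| -> set R) (i : 'I_n) : set R :=
  \bigcap_(k in [set k | enum_val k = i]) A k.
have mext D A i : (forall k, measurable (A k)) -> measurable (@ext D A i).
  by move=> mA; apply: fin_bigcap_measurable.
have extT (D : {set 'I_n}) A i : i \notin D -> @ext D A i = setT.
  move=> iD; apply/seteqP; split => // x _ k /= ki.
  by move: iD; rewrite -ki enum_valP.
have extE D A : Y D @^-1` tuple_box A = \bigcap_i (X i @^-1` @ext D A i).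
  apply/seteqP; split => w /= Aw.
    by move=> i _ k /= <-; have := Aw k; rewrite tnth_mktuple.
  by move=> k; rewrite tnth_mktuple; exact: (Aw (enum_val k) I k).
have boxes : forall A, tuple_boxes R #|K| A -> forall B, tuple_boxes R #|L| B ->
    (P (Y K @^-1` A `&` Y L @^-1` B) = P (Y K @^-1` A) * P (Y L @^-1` B))%E.
  move=> _ [A mA <-] _ [B mB <-]; rewrite !extE -bigcapI.
  under eq_bigcapr do rewrite -preimage_setI.
  rewrite !indep; [|by move=> i; exact: mext..|].
    rewrite -big_split/=; apply: eq_bigr => i _.
    (* As [K] and [L] are disjoint, at least one of the two constraints on coordinate [i] is [setT],
       so each factor splits. *)
    have [iK|iK] := boolP (i \in K); last first.
      by rewrite extT// setTI preimage_setT probability_setT mul1e.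
    rewrite (extT L) ?setIT ?preimage_setT ?probability_setT ?mule1//.
    apply/negP => iL; have := finset.in_set0 i.
    by rewrite -KL inE iK iL.
  by move=> i; apply: measurableI; exact: mext.
have mY D A : measurable A -> measurable (Y D @^-1` A).
  by move=> mA; rewrite -[X in measurable X]setTI; exact: measurable_funPT.
have rectangles A B : measurable A -> measurable B ->
    (P (Y K @^-1` A `&` Y L @^-1` B) = P (Y K @^-1` A) * P (Y L @^-1` B))%E.
  move=> mA mB.
  (* Boxes are replaced by measurable sets one side at a time: first [A] is reduced to a box with
     [B] arbitrary, then [B] is reduced with [A] a box. *)
  apply: (@pi_system_independent _ _ _ _ _ _ (tuple_boxes R #|K|)) => //.
  - exact: measurable_tuple_boxes.
  - exact: setI_closed_tuple_boxes.
  - exact: tuple_boxes_setT.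
  - exact: mY.
  move=> {mA}A bA; rewrite setIC muleC.
  apply: (@pi_system_independent _ _ _ _ _ _ (tuple_boxes R #|L|)) => //.
  - exact: measurable_tuple_boxes.
  - exact: setI_closed_tuple_boxes.
  - exact: tuple_boxes_setT.
  - apply: mY; rewrite measurable_tuple_boxes; exact: sub_sigma_algebra.
  by move=> {mB}B bB; rewrite setIC muleC boxes.
have mfX : measurable_fun setT fX := measurableT_comp mf (msub K).
have mgX : measurable_fun setT gX := measurableT_comp mg (msub L).
pose U : {RV P >-> R} := mfun_Sub (mem_set mfX).
pose V : {RV P >-> R} := mfun_Sub (mem_set mgX).
rewrite (@expectationM_independent _ _ _ _ U V)// => A B mA mB.
apply: (rectangles (f @^-1` A) (g @^-1` B)).
  by rewrite -[X in measurable X]setTI; exact: mf.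
by rewrite -[X in measurable X]setTI; exact: mg.
Qed.

(** * Truncation and monotone convergence for a common exponent *)

Lemma negatively_associated_expectation_expR_sum_le1 (R : realType)
    (d : measure_display) (T : measurableType d) (P : probability T R)
    (n : nat) (X : 'I_n -> {RV P >-> R}) (e : R) :
  0 <= e -> negatively_associated X ->
  (forall i, 'E_P[fun w => expR (e * X i w)] <= 1)%E ->
  ('E_P[fun w => expR (e * \sum_i X i w)] <= 1)%E.
Proof.
move=> e0 NA X1.
(* the test functions must be integrable, hence the truncation at level M *)
pose h (M : nat) (i : 'I_n) (x : R) := Num.min (expR (e * x)) M%:R.
have h_ge0 M i x : 0 <= h M i x by rewrite le_min expR_ge0 ler0n.
have h_leM M i x : h M i x <= M%:R by rewrite ge_min lexx orbT.
have h_nd M i : {homo h M i : x y / x <= y}.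
  move=> x y xy; rewrite le_min !ge_min lexx orbT andbT ler_expR.
  by rewrite ler_wpM2l.
have mh M i : measurable_fun setT (h M i) by exact: nondecreasing_measurable.
pose g M w := (\prod_i h M i (X i w))%:E.
have mg M : measurable_fun setT (g M).
  apply/measurable_EFinP; apply: measurable_prod => i _.
  exact: measurableT_comp.
have g_ge0 M w : setT w -> (0 <= g M w)%E by rewrite lee_fin prodr_ge0.
have g_nd w : setT w -> {homo g^~ w : M N / (M <= N)%N >-> (M <= N)%E}.
  move=> _ M N MN; rewrite lee_fin; apply: ler_prod => i _; rewrite h_ge0/=.
  by rewrite le_min !ge_min lexx/= ler_nat MN orbT.
have g1 M : (\int[P]_w g M w <= 1)%E.
  have inT i : i \in [set: 'I_n]%SET = predT i by rewrite inE.
  have := @negatively_associated_prod _ _ _ _ _ _ _ _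
    (h_nd M) (h_ge0 M) (h_leM M) [set: 'I_n]%SET NA.
  rewrite unlock; under eq_integral do rewrite (eq_bigl _ _ inT).
  move=> /le_trans; apply; rewrite (eq_bigl _ _ inT).
  (* The lower bound 0 is carried along because multiplying upper bounds requires nonnegative
     factors. *)
  suff /andP[] : (0 <= \prod_i \int[P]_w (h M i (X i w))%:E <= 1)%E by [].
  elim/big_ind : _ => [|x y /andP[x0 x1] /andP[y0 y1]|i _].
  - by rewrite lee01 lexx.
  - by rewrite mule_ge0//= -[leRHS]mule1 lee_pmul.
  - rewrite integral_ge0/=; last by move=> w _; rewrite lee_fin.
    apply: le_trans (X1 i); rewrite unlock.
    apply: ge0_le_integral => //.
    + by move=> w _; rewrite lee_fin.
    + by apply/measurable_EFinP; exact: measurableT_comp.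
    + apply/measurable_EFinP; apply: measurableT_comp => //.
      exact: measurable_funM.
    + by move=> w _; rewrite lee_fin ge_min lexx.
(* For fixed [w] the sequence is eventually constant: once [M] exceeds the sum of all the
   exponentials, it exceeds each of them and no truncation remains. *)
have g_lim w : limn (g^~ w) = (expR (e * \sum_i X i w))%:E.
  apply/cvg_lim => //; apply: cvg_near_cst.
  near=> M; congr (_%:E); rewrite mulr_sumr expR_sum; apply: eq_bigr => i _.
  apply: min_l; apply: (@le_trans _ _ (\sum_j expR (e * X j w))).
    by rewrite (bigD1 i)//= lerDl sumr_ge0.
  by near: M; exact: nbhs_infty_ger.
rewrite unlock.
have cg : (\int[P]_w g M w)%E @[M --> \oo] -->
    (\int[P]_w (expR (e * \sum_i X i w))%:E)%E.
  rewrite -(@eq_integral _ _ _ P setT _ (fun w => limn (g^~ w))); last first.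
    by move=> w _; rewrite g_lim.
  exact: cvg_monotone_convergence.
rewrite -(cvg_lim _ cg)//; apply: lime_le.
  by apply/cvg_ex; eexists; exact: cg.
by near=> M; exact: g1.
Unshelve. all: by end_near.
Qed.

Theorem proposition7 (R : realType) (d : measure_display)
    (T : measurableType d) (P : probability T R) (n : nat)
    (X : 'I_n.+1 -> {RV P >-> R}) (eta : 'I_n.+1 -> R)
    (eta_gt0 : forall i, 0 < eta i)
    (X_le0 : forall i, X i ⊴_[P, eta i] cst 0) :
  let S := fun w => \sum_(i < n.+1) X i w in
  [/\ S ⊴_[P, (\sum_(i < n.+1) (eta i)^-1)^-1] cst 0,
      negatively_associated X ->
        S ⊴_[P, \big[Num.min/eta ord0]_(i < n.+1) eta i] cst 0
    & mutually_independent X -> negatively_associated X].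
Proof.
move=> S.
have mX (c : R) i : measurable_fun setT (fun w => c * X i w).
  exact: measurable_funM.
have X1 i : ('E_P[fun w => expR (eta i * X i w)] <= 1)%E.
  by have := X_le0 i; rewrite /exp_le; under eq_fun do rewrite subr0.
split; last exact: mutually_independent_negatively_associated.
- rewrite /exp_le; set s := \sum_i (eta i)^-1.
  have s_gt0 : 0 < s.
    rewrite /s (bigD1 ord0)//= ltr_pwDl ?invr_gt0// sumr_ge0// => i _.
    by rewrite invr_ge0 ltW.
  (* The sum is rewritten as a convex combination of the [eta i * X i w] with weights
     [s^-1 / eta i]. *)
  have -> : (fun w => expR (s^-1 * (S w - cst 0 w))) =
      (fun w => expR (\sum_i s^-1 / eta i * (eta i * X i w))).
    apply/funext => w; rewrite subr0 mulr_sumr; congr expR.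
    by apply: eq_bigr => i _; rewrite mulrA divfK ?gt_eqF.
  apply: expectation_expR_sum_le1 => //.
    by move=> i; rewrite mulr_ge0 ?invr_ge0 ?ltW.
  by rewrite -mulr_sumr mulVf ?gt_eqF.
- move=> NA; rewrite /exp_le; set m := \big[Num.min/_]_i eta i.
  (* The default value [eta ord0] is a member of the family, so [m] is its true minimum and is
     positive. *)
  have m_gt0 : 0 < m by apply/bigmin_gtP; split.
  rewrite (_ : (fun w => _) = fun w => expR (m * \sum_i X i w)); last first.
    by apply/funext => w; rewrite subr0.
  apply: negatively_associated_expectation_expR_sum_le1 => //; first exact: ltW.
  move=> i.
  (* A one-term sum with weight [m / eta i], at most 1, lowers the exponent from [eta i] to [m]. *)
  have -> : (fun w => expR (m * X i w)) =
      (fun w => expR (\sum_(k < 1) m / eta i * (eta i * X i w))).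
    by apply/funext => w; rewrite big_ord1 mulrA divfK ?gt_eqF.
  apply: expectation_expR_sum_le1 => // [_|].
    by rewrite mulr_ge0 ?invr_ge0 ?ltW.
  by rewrite big_ord1 ler_pdivrMr ?mul1r ?bigmin_le_cond.
Qed.
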